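(* Let $(X,\preceq,G)$ be a complete partially ordered $G$-metric space and let $T:X\to X$ be a non-decreasing map such that $x_0\preceq Tx_0$ for some $x_0\in X$. Suppose that there exist $\psi\in\Psi$ and $\phi\in\Phi$ such that for all $x,y,z\in X$ with $x\preceq y\preceq z$, $$\psi(G(Tx,Ty,Tz))\le\psi(G(x,y,z))-\phi(G(x,y,z)).$$ If either $T$ is $G$-continuous or $(X,\preceq,G)$ is regular non-decreasing, then $T$ has a fixed point in $X$.
   Context: A $G$-metric on a nonempty set $X$ is a function $G:X\times X\times X\to[0,\infty)$ such that: (G1) $G(x,y,z)=0$ if $x=y=z$; (G2) $0<G(x,x,y)$ for all $x,y\in X$ with $x\ne y$; (G3) $G(x,x,y)\le G(x,y,z)$ for all $x,y,z\in X$ with $y\neq z$; (G4) $G$ is invariant under all permutations of its three arguments; (G5) $G(x,y,z)\le G(x,a,a)+G(a,y,z)$ for all $x,y,z,a\in X$. A partially ordered $G$-metric space $(X,\preceq,G)$ is a nonempty set $X$ with a partial order $\preceq$ and a $G$-metric $G$. A sequence $(x_n)$ $G$-converges to $x$ if $G(x,x_n,x_m)\to0$ as $n,m\to\infty$; it is $G$-Cauchy if $G(x_n,x_m,x_l)\to 0$ as $n,m,l\to\infty$; the space is complete if every $G$-Cauchy sequence $G$-converges to some point of $X$. $T$ is $G$-continuous if $x_n\to x$ implies $Tx_n\to Tx$ (in the sense of $G$-convergence). $T$ is non-decreasing if $x\preceq y$ implies $Tx\preceq Ty$. $(X,\preceq,G)$ is regular non-decreasing if for every $\preceq$-non-decreasing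 sequence $(x_n)$ in $X$ with $x_n\to x^*$ one has $x_n\preceq x^*$ for all $n\in\mathbb N$. $\Psi$ is the set of functions $\psi:[0,\infty)\to[0,\infty)$ that are continuous, non-decreasing and satisfy $\psi(t)=0$ iff $t=0$. $\Phi$ is the set of functions $\phi:[0,\infty)\to[0,\infty)$ that are lower semi-continuous and satisfy $\phi(t)=0$ iff $t=0$. *)

(* Defs.v *)
From HB Require Import structures.
From mathcomp Require Import all_boot all_order all_algebra.
From mathcomp Require Import all_classical all_reals all_analysis.

Set Implicit Arguments.
Unset Strict Implicit.
Unset Printing Implicit Defensive.

Import Order.TTheory GRing.Theory Num.Theory.
Import numFieldNormedType.Exports.

Local Open Scope classical_set_scope.
Local Open Scope ring_scope.

Record is_Gmetric (R : realType) (X : Type) (G : X -> X -> X -> R) : Prop := {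
  Gmetric_ge0 : forall x y z, 0 <= G x y z ;
  Gmetric_refl : forall x y z, x = y -> y = z -> G x y z = 0 ;
  Gmetric_gt0 : forall x y, x <> y -> 0 < G x x y ;
  Gmetric_le : forall x y z, y <> z -> G x x y <= G x y z ;
  Gmetric_perm : forall x y z,
    [/\ G x y z = G x z y, G x y z = G y x z, G x y z = G y z x,
        G x y z = G z x y & G x y z = G z y x] ;
  Gmetric_rect : forall x y z a, G x y z <= G x a a + G a y z }.

Section GConvergence.
Context {R : realType} {X : Type} (G : X -> X -> X -> R).

Definition Gcvg (u : nat -> X) (x : X) : Prop :=
  G x (u p.1) (u p.2) @[p --> filter_prod \oo \oo] --> (0 : R).

Definition Gcauchy (u : nat -> X) : Prop :=
  G (u p.1.1) (u p.1.2) (u p.2)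
    @[p --> filter_prod (filter_prod \oo \oo) \oo] --> (0 : R).

Definition Gcomplete : Prop :=
  forall u : nat -> X, Gcauchy u -> exists x, Gcvg u x.

Definition Gcontinuous (T : X -> X) : Prop :=
  forall (u : nat -> X) (x : X), Gcvg u x -> Gcvg (T \o u) (T x).

End GConvergence.

Definition regular_nondecreasing (R : realType) (d : Order.disp_t)
    (X : porderType d) (G : X -> X -> X -> R) : Prop :=
  forall (u : nat -> X) (x : X),
    nondecreasing_seq u -> Gcvg G u x -> forall n, (u n <= x)%O.

(* Functions on [0, +oo[ are represented by functions R -> R of which only the
   restriction to [0, +oo[ is constrained; (lower semi-)continuity refers to
   the subspace topology of [0, +oo[. *)
Definition Psi (R : realType) : set (R -> R) := [set psi : R -> R |
  [/\ forall t : R, 0 <= t -> 0 <= psi t,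
      {within `[0, +oo[, continuous psi},
      forall s t : R, 0 <= s -> s <= t -> psi s <= psi t &
      forall t : R, 0 <= t -> (psi t = 0 <-> t = 0)]].

Definition Phi (R : realType) : set (R -> R) := [set phi : R -> R |
  [/\ forall t : R, 0 <= t -> 0 <= phi t,
      lower_semicontinuous
        ((fun t => (phi t)%:E) : subspace (`[0, +oo[ : set R) -> \bar R) &
      forall t : R, 0 <= t -> (phi t = 0 <-> t = 0)]].

(* Main.v *)
(* Write D x y for G x y y, a quasi-metric with D y x <= 2 D x y. The
   contraction makes T nonexpansive for D on comparable points, and for every
   r > 0 it cannot hold between two values both close to r. Along the orbit
   u of x0 this forces the steps D (u n) (u n.+1) to decrease to 0. Moreover,
   D (u n) (u m) and D (u n.+1) (u m.+1) differ by at most a few steps, so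
   that, with n large and fixed, D (u n) (u m) cannot cross a given eps as m
   increases: u is G-Cauchy. Its limit is fixed because T u also converges to
   the image of the limit, by continuity or by nonexpansiveness. *)
Require Import Defs.
From mathcomp Require Import all_boot all_order all_algebra.
From mathcomp Require Import all_classical all_reals all_analysis.
From mathcomp Require Import lra.

Local Open Scope classical_set_scope.
Local Open Scope ring_scope.

Import Order.TTheory GRing.Theory Num.Theory.
Import numFieldNormedType.Exports.

Section WeakContraction.
Context {R : realType} (psi phi : R -> R).
Hypotheses (psiP : Psi psi) (phiP : Phi phi).

Lemma Phi_gt0 (t : R) : 0 < t -> 0 < phi t.
Proof.
case: phiP => phi_ge0 _ phi_eq0 t0.
rewrite lt_neqAle phi_ge0 ?ltW// andbT eq_sym.
by apply/eqP => /phi_eq0 => /(_ (ltW t0)) t_eq0; rewrite t_eq0 ltxx in t0.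
Qed.

(** If [t < s], monotonicity of [psi] forces [phi t <= 0], hence [t = 0]; then [psi s = 0] and
    [s = 0], a contradiction. *)
Lemma weak_contraction_le (s t : R) : 0 <= s -> 0 <= t ->
  psi s <= psi t - phi t -> s <= t.
Proof.
case: psiP => psi_ge0 _ psi_mono psi_eq0; case: (phiP) => phi_ge0 _ _ s0 t0 st.
rewrite leNgt; apply/negP => ts.
have psits := psi_mono _ _ t0 (ltW ts).
have [t_gt0|] := ltP 0 t; first by have := Phi_gt0 _ t_gt0; lra.
move=> t_le0; have tE : t = 0 by apply/le_anti; rewrite t_le0 t0.
have psit0 : psi t = 0 by apply/psi_eq0.
have psis0 : psi s = 0.
  by apply/le_anti; rewrite psi_ge0// andbT; have := phi_ge0 _ t0; lra.
by move/psi_eq0 : psis0 => /(_ s0); lra.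
Qed.

(** Near [r], [psi] stays within [phi r / 4] of [psi r] by continuity and [phi] stays above
    [phi r / 2] by lower semicontinuity, so [psi t - psi s < phi r / 2 < phi t]. *)
Lemma weak_contraction_gap (r : R) : 0 < r ->
  exists2 delta, 0 < delta & forall s t, 0 <= s -> 0 <= t ->
    `|r - s| < delta -> `|r - t| < delta -> psi t - phi t < psi s.
Proof.
move=> r0; have p0 := Phi_gt0 _ r0.
have p20 : 0 < phi r / 4 by lra.
have rI : `[0, +oo[%classic r by rewrite /= in_itv/= ltW.
case: psiP => _ psi_cont _ _; case: (phiP) => _ phi_lsc _.
have /cvgrPdist_lt /(_ _ p20) := psi_cont r.
rewrite /nbhs /= -nbhs_subspace_in// => -[d1 /= d10 H1].
have [|V] := phi_lsc r (phi r / 2); first by rewrite lte_fin; lra.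
rewrite /nbhs /= -nbhs_subspace_in// => -[d2 /= d20 H2] HV.
exists (Num.min d1 d2); first by rewrite lt_min d10.
move=> s t s0 t0; rewrite !lt_min => /andP[s1 _] /andP[t1 t2].
have Hs : `|psi r - psi s| < phi r / 4 by apply: H1 => //=; rewrite in_itv/= s0.
have Ht : `|psi r - psi t| < phi r / 4 by apply: H1 => //=; rewrite in_itv/= t0.
have : phi r / 2 < phi t.
  by rewrite -lte_fin; apply: HV; apply: H2 => //=; rewrite in_itv/= t0.
by move: Hs Ht; rewrite !ltr_norml => /andP[? ?] /andP[? ?]; lra.
Qed.

End WeakContraction.

Section GMetric.
Context {R : realType} {X : Type} {G : X -> X -> X -> R}.
Hypothesis G_metric : is_Gmetric G.

Let D x y := G x y y.

Lemma Gquasi_triangle (x y z : X) : D x z <= D x y + D y z.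
Proof. exact: Gmetric_rect. Qed.

(** The rectangle inequality for [G x x y] through [y] yields two terms, both equal to [D x y]. *)
Lemma Gquasi_sym (x y : X) : D y x <= 2 * D x y.
Proof.
rewrite /D; have [_ _ -> _ _] := Gmetric_perm G_metric y x x.
have := Gmetric_rect G_metric x x y y.
by have [_ -> _ _ _] := Gmetric_perm G_metric y x y; lra.
Qed.

(** Two rectangle inequalities through [a] give [D x a + D y a + D z a]; reversing each term costs
    the factor 2. *)
Lemma Gle_quasi (a x y z : X) : G x y z <= 2 * (D a x + D a y + D a z).
Proof.
have h1 := Gmetric_rect G_metric x y z a.
have h2 := Gmetric_rect G_metric y a z a.
have [_ e1 _ _ _] := Gmetric_perm G_metric a y z.
have [_ _ e2 _ _] := Gmetric_perm G_metric z a a.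
have := Gquasi_sym a x; have := Gquasi_sym a y; have := Gquasi_sym a z.
by rewrite /D; lra.
Qed.

(** This serves as uniqueness of limits: otherwise [D x y] is positive, yet [D x z + 2 * D y z]
    bounds it by three quarters of itself. *)
Lemma Gquasi_small_eq (x y : X) :
  (forall e, 0 < e -> exists z, D x z < e /\ D y z < e) -> x = y.
Proof.
move=> h; apply: contrapT => xy.
have := Gmetric_gt0 G_metric (nesym xy).
have [_ _ e _ _] := Gmetric_perm G_metric x y y; rewrite -e -/(D x y) => Dxy.
have [|z []] := h (D x y / 4); first by lra.
by have := Gquasi_triangle x z y; have := Gquasi_sym y z; lra.
Qed.

Lemma Gcvg_quasi (u : nat -> X) (x : X) : Gcvg G u x ->
  forall e, 0 < e -> \forall n \near \oo, D x (u n) < e.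
Proof.
move=> /cvgr0Pnorm_lt h e /h [[A B] /= [nA nB] AB].
apply: filterS (filterI nA nB) => n [An Bn].
by apply: le_lt_trans (ler_norm _) (AB (n, n) _).
Qed.

Lemma Gcauchy_quasi (u : nat -> X) :
  (forall e, 0 < e ->
     exists N, forall m, (N <= m)%N -> D (u N) (u m) < e) -> Gcauchy G u.
Proof.
move=> h; apply/cvgr0Pnorm_lt => e e0.
(* [Gle_quasi] doubles a sum of three such distances, all taken from [u N]. *)
have [|N hN] := h (e / 6); first by lra.
pose A := [set n | (N <= n)%N].
have nA : nbhs \oo A by exact: nbhs_infty_ge.
exists (A `*` A, A); first by split => //; exists (A, A).
move=> [[n m] l] /= [[/hN hn /hN hm] /hN hl].
rewrite ger0_norm ?(Gmetric_ge0 G_metric)//.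
by apply: le_lt_trans (Gle_quasi (u N) _ _ _) _; lra.
Qed.

End GMetric.

Section Orbit.
Context {R : realType} {d : Order.disp_t} {X : porderType d}.
Context {G : X -> X -> X -> R} {T : X -> X} {psi phi : R -> R} {x0 : X}.
Hypotheses (G_metric : is_Gmetric G) (psiP : Psi psi) (phiP : Phi phi).
Hypothesis T_nondecreasing : {homo T : x y / (x <= y)%O}.
Hypothesis T_start : (x0 <= T x0)%O.
Hypothesis T_contraction : forall x y, (x <= y)%O ->
  psi (G (T x) (T y) (T y)) <= psi (G x y y) - phi (G x y y).

Let D x y := G x y y.
Let u n := iter n T x0.

Let D_ge0 x y : 0 <= D x y.
Proof. exact: Gmetric_ge0. Qed.

Lemma orbit_nondecreasing : nondecreasing_seq u.
Proof. by apply/nondecreasing_seqP; elim=> //= n /T_nondecreasing. Qed.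

Lemma nonexpansive (x y : X) : (x <= y)%O -> D (T x) (T y) <= D x y.
Proof.
by move=> /T_contraction; apply: (weak_contraction_le _ _ psiP phiP); exact: D_ge0.
Qed.

Lemma orbit_step_small (e : R) : 0 < e ->
  exists N, forall n, (N <= n)%N -> D (u n) (u n.+1) < e.
Proof.
move=> e0; pose s n := D (u n) (u n.+1).
have u_le n : (u n <= u n.+1)%O by exact: orbit_nondecreasing.
have s_dec : nonincreasing_seq s.
  by apply/nonincreasing_seqP => n; exact: nonexpansive.
have s_inf : has_inf (range s).
  by split; [exists (s 0); exists 0 | exists 0 => _ [n _ <-]; exact: D_ge0].
have inf_le n : inf (range s) <= s n by apply: ge_inf; [case: s_inf|exists n].
(* If the infimum were positive, a step [s n] within [delta] of it, together with [s n.+1] lying in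
   between, would violate the gap. *)
have inf0 : inf (range s) <= 0.
  rewrite leNgt; apply/negP => /(weak_contraction_gap _ _ psiP phiP)[delta delta0].
  have [_ [n _ <-] sn] := inf_adherent delta0 s_inf.
  move=> /(_ (s n.+1) (s n) (D_ge0 _ _) (D_ge0 _ _)).
  have := s_dec _ _ (leqnSn n); have := inf_le n; have := inf_le n.+1.
  move=> i1 i2 i3; rewrite !ltr_norml => gap.
  have := T_contraction _ _ (u_le n); rewrite leNgt => /negP; apply.
  by apply: gap; apply/andP; split; lra.
have [_ [N _ <-] sN] := inf_adherent e0 s_inf.
by exists N => n /s_dec; rewrite -/(s n); lra.
Qed.

Lemma orbit_small (e : R) : 0 < e ->
  exists N, forall m, (N <= m)%N -> D (u N) (u m) < e.
Proof.
move=> e0; have [delta delta0 gap] := weak_contraction_gap _ _ psiP phiP _ e0.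
(* One quarter bounds the overshoot past [e]; the other three bound the change of [D] under [T],
   where one of the two steps used is reversed and so counts twice. *)
have [|N hN] := orbit_step_small (delta / 4); first by lra.
exists N => m Nm; rewrite -(subnKC Nm); elim: (m - N)%N => [|k IH].
  by rewrite addn0 /D (Gmetric_refl G_metric).
(* At a first crossing, [D (u N) (u p.+1)] lies in [[e, e + delta / 4)], and its image under [T] is
   also within [delta] of [e]. *)
rewrite addnS ltNge; apply/negP => far.
set p := (N + k)%N in IH far *.
have Np : (N <= p)%N by exact: leq_addr.
have h1 := hN _ (leqnn N); have h2 := hN _ Np; have h3 := hN _ (leqW Np).
have t1 := Gquasi_triangle G_metric (u N) (u p) (u p.+1).
have t2 := Gquasi_triangle G_metric (u N.+1) (u N) (u p.+2).
have t3 := Gquasi_triangle G_metric (u N) (u p.+1) (u p.+2).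
have t4 := Gquasi_triangle G_metric (u N) (u N.+1) (u p.+1).
have t5 := Gquasi_triangle G_metric (u N.+1) (u p.+2) (u p.+1).
have s1 := Gquasi_sym G_metric (u N) (u N.+1).
have s2 := Gquasi_sym G_metric (u p.+1) (u p.+2).
have := T_contraction _ _ (orbit_nondecreasing _ _ (leqW Np)).
rewrite leNgt => /negP; apply.
move: IH far h1 h2 h3; rewrite /D => IH far h1 h2 h3.
rewrite -/(u N.+1) -/(u p.+2).
by apply: gap; rewrite ?(Gmetric_ge0 G_metric)// ltr_norml; apply/andP; split; lra.
Qed.

End Orbit.

Theorem theorem2p5 (R : realType) (d : Order.disp_t) (X : porderType d)
    (G : X -> X -> X -> R) (T : X -> X)
    (X_nonempty : inhabited X)
    (G_metric : is_Gmetric G)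
    (G_complete : Gcomplete G)
    (T_nondecreasing : {homo T : x y / (x <= y)%O})
    (T_start : exists x0 : X, (x0 <= T x0)%O)
    (T_contraction : exists psi phi : R -> R,
      [/\ Psi psi, Phi phi &
          forall x y z : X, (x <= y)%O -> (y <= z)%O ->
            psi (G (T x) (T y) (T z)) <= psi (G x y z) - phi (G x y z)])
    (T_continuous_or_regular : Gcontinuous G T \/ regular_nondecreasing G) :
  exists x : X, T x = x.
Proof.
have [x0 x0T] := T_start; have [psi [phi [psiP phiP Tpsi]]] := T_contraction.
have T_psi x y (xy : (x <= y)%O) := Tpsi x y y xy (lexx y).
pose u n := iter n T x0.
have [x ux] : exists x, Gcvg G u x.
  apply/G_complete/(Gcauchy_quasi G_metric).
  exact: (orbit_small G_metric psiP phiP T_nondecreasing x0T T_psi).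
exists x; apply: (Gquasi_small_eq G_metric) => e e0.
have near_x := Gcvg_quasi u x ux.
have near_Tx : \forall n \near \oo, G (T x) (u n.+1) (u n.+1) < e.
  case: T_continuous_or_regular => [/(_ _ _ ux)|/(_ u x) u_le].
    by move=> Tux; exact: (Gcvg_quasi _ _ Tux _ e0).
  (* Regularity makes [u n] and [x] comparable, so [T] is nonexpansive on them; reversing [D] before
     and after applying [T] costs a factor 4. *)
  have e2 : 0 < e / 4 by lra.
  apply: filterS (near_x _ e2) => n xn.
  have unx : (u n <= x)%O.
    by apply: u_le => //; exact: orbit_nondecreasing.
  have := nonexpansive G_metric psiP phiP T_psi _ _ unx.
  have := Gquasi_sym G_metric x (u n).
  by have := Gquasi_sym G_metric (T (u n)) (T x); rewrite /=; lra.
have [N _ hN] := near_x _ e0.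
have [M _ hM] := near_Tx.
(* The successor appears because [near_Tx] controls [u n.+1]. *)
exists (u (maxn N M).+1); split; first by apply: hM; exact: leq_maxr.
by apply: hN; exact: leqW (leq_maxl _ _).
Qed.
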